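(* Let $V$ be a non-zero finite dimensional $\mathbb{F}_q$-vector space. As a set $B_V$ is the disjoint union of the strata $\Omega_{\mathcal{F}}$ for all flags $\mathcal{F}$ of $V$.
   Context: $\mathbb{F}_q$ is a finite field with $q$ elements; all tensor and fiber products are over $\mathbb{F}_q$. For a non-zero finite dimensional $\mathbb{F}_q$-vector space $V'$, $P_{V'}:=\operatorname{Proj}(\operatorname{Sym}V')$ is the projective space which represents the functor sending an $\mathbb{F}_q$-scheme $S$ to the set of coherent subsheaves $\mathcal{E}_{V'}\subset V'\otimes\mathcal{O}_S$ such that $(V'\otimes\mathcal{O}_S)/\mathcal{E}_{V'}$ is locally free of rank $1$. $B_V\subset\prod_{0\neq V'\subset V}P_{V'}$ (product over all non-zero subspaces) is the closed subscheme representing the subfunctor of all tuples $\mathcal{E}_\bullet=(\mathcal{E}_{V'})_{V'}$ with $\mathcal{E}_{V''}\subset\mathcal{E}_{V'}$ for all $0\neq V''\subset V'\subset V$. A flag $\mathcal{F}$ of $V$ is a set of subspaces of $V$ which is totally ordered by inclusion and contains $0$ and $V$. $B_{\mathcal{F}}\subset B_V$ is the closed subscheme representing the subfunctor of those $\mathcal{E}_\bullet$ with $V''\otimes\mathcal{O}_S\subset\mathcal{E}_{V'}$ for all $0\neq V''\subset V'\subset V$ such that there exists $W\in\mathcal{F}$ with $V''\subset W$ and $V'\not\subset W$. $U_{\mathcal{F}}\subset B_V$ is the open subscheme representing the subfunctor of those $\mathcal{E}_\bullet$ with $V'\otimes\mathcal{O}_S=\mathcal{E}_{V'}+(V''\otimes\mathcal{O}_S)$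 for all $0\neq V''\subset V'\subset V$ such that there exists no $W\in\mathcal{F}$ with $V''\subset W$ and $V'\not\subset W$. The stratum associated to $\mathcal{F}$ is the locally closed subscheme $\Omega_{\mathcal{F}}:=B_{\mathcal{F}}\cap U_{\mathcal{F}}$. *)

(* Defs.v *)
From HB Require Import structures.
From mathcomp Require Import all_boot all_order all_algebra.
From mathcomp Require Import boolp classical_sets.

Set Implicit Arguments.
Unset Strict Implicit.
Unset Printing Implicit Defensive.

Import GRing.Theory.

Local Open Scope classical_set_scope.
Local Open Scope ring_scope.

(* An F-algebra is a commutative ring R with a morphism iota : F -> R, and an
   F-scheme is described by its functor of points on F-algebras (equivalently,
   on affine F-schemes S = Spec R).  Quasi-coherent sheaves on Spec R are
   R-modules, and their quasi-coherent subsheaves are submodules. *)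

Section Modules.
Variables (R : comPzRingType) (M : lmodType R).
Implicit Types N E : set M.

Definition submodule N : Prop :=
  N 0 /\ forall (a : R) (x y : M), N x -> N y -> N (a *: x + y).

Definition submodule_gen (A : set M) : set M := smallest submodule A.

Definition submodule_add N E : set M := [set x + y | x in N & y in E].

(* The localization (N / E)_f is free of rank 1 over R_f.  A basis vector can
   be rescaled by a power of the unit f so as to come from some v in N; the two
   clauses say that v spans (N / E)_f and that v has no annihilator in R_f, with
   denominators cleared. *)
Definition quotient_free1_at N E (f : R) : Prop :=
  exists v : M,
    [/\ N v,
        forall w, N w -> exists (k : nat) (a : R), E (f ^+ k *: w - a *: v)
      & forall (k : nat) (a : R), E ((f ^+ k * a) *: v) ->
          exists m : nat, f ^+ m * a = 0].

(* N / E is locally free of rank 1 on Spec R: Spec R is covered by finitely many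
   principal opens D(f_i) over which N / E is free of rank 1. *)
Definition quotient_locally_free1 N E : Prop :=
  exists (m : nat) (c f : 'I_m -> R),
    \sum_i c i * f i = 1 /\ forall i, quotient_free1_at N E (f i).

End Modules.

Notation tensor V R := 'rV[R]_(\dim {:V}).

Section Space.
Variables (F : finFieldType) (V : vectType F).

Section ScalarExtension.
Variables (R : comPzRingType) (iota : {rmorphism F -> R}).

(* V (x) R in the coordinates given by a basis of V, and v |-> v (x) 1; the
   universal property is tensor_universal below. *)
Definition tensor1 (v : V) : tensor V R :=
  \row_i iota (coord (vbasis {:V}) i v).

(* U (x) R as a submodule of V (x) R, as R is flat over F. *)
Definition tensor_sub (U : {vspace V}) : set (tensor V R) :=
  submodule_gen (tensor1 @` [set v | v \in U]).

Lemma tensor1_linear (a : F) (u v : V) :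
  tensor1 (a *: u + v) = iota a *: tensor1 u + tensor1 v.
Proof. by apply/rowP => i; rewrite !mxE linearP rmorphD rmorphM. Qed.

Lemma tensor1_basis (i : 'I_(\dim {:V})) : tensor1 (vbasis {:V})`_i = delta_mx 0 i.
Proof.
apply/rowP => j; rewrite !mxE coord_free ?(basis_free (vbasisP _)) //.
by rewrite eq_sym; case: eqP; rewrite ?rmorph1 ?rmorph0.
Qed.

Lemma tensor_universal (N : lmodType R) (g : V -> N) :
  (forall (a : F) (u v : V), g (a *: u + v) = iota a *: g u + g v) ->
  (exists h : {linear tensor V R -> N}, forall v, h (tensor1 v) = g v) /\
  (forall h1 h2 : {linear tensor V R -> N},
     (forall v, h1 (tensor1 v) = h2 (tensor1 v)) -> h1 =1 h2).
Proof.
move=> g_lin; split; last first.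
  move=> h1 h2 eq_h w; rewrite (row_sum_delta w) !linear_sum /=.
  by apply: eq_bigr => i _; rewrite !linearZ -tensor1_basis eq_h.
pose h (w : tensor V R) := \sum_i w 0 i *: g (vbasis {:V})`_i.
have h_lin : linear h.
  move=> a x y; rewrite /h scaler_sumr -big_split; apply: eq_bigr => i _.
  by rewrite !mxE scalerDl scalerA.
pose hL := GRing.isLinear.Build R (tensor V R) N *:%R h h_lin.
exists (HB.pack_for {linear tensor V R -> N} h hL) => v /=.
have gD u1 u2 : g (u1 + u2) = g u1 + g u2.
  by rewrite -[u1 in LHS]scale1r g_lin rmorph1 scale1r.
have g0 : g 0 = 0 by apply: (addrI (g 0)); rewrite -gD !addr0.
have gZ a u : g (a *: u) = iota a *: g u.
  by rewrite -[a *: u]addr0 g_lin g0 addr0.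
rewrite [in RHS](coord_vbasis (memvf v)) (big_morph g gD g0).
by apply: eq_bigr => i _; rewrite gZ !mxE.
Qed.

End ScalarExtension.

Definition nonzero_subspace := {U : {vspace V} | (U != 0)%VS}.

(* Families (E_U), U ranging over the non-zero subspaces of V, of subsets of
   V (x) R. *)
Definition family (R : comPzRingType) := nonzero_subspace -> set (tensor V R).

(* A subfunctor of R |-> family R; only the values on objects are recorded. *)
Definition subfunctor :=
  forall R : comPzRingType, {rmorphism F -> R} -> set (family R).

(* The R-valued points of P_U = Proj (Sym U). *)
Definition P_points (R : comPzRingType) (iota : {rmorphism F -> R})
    (U : {vspace V}) : set (set (tensor V R)) :=
  [set E | [/\ submodule E, E `<=` tensor_sub iota U
             & quotient_locally_free1 (tensor_sub iota U) E]].

Definition B : subfunctor := fun R iota =>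
  [set E | (forall U, P_points iota (val U) (E U)) /\
           (forall U1 U2 : nonzero_subspace,
              (val U1 <= val U2)%VS -> E U1 `<=` E U2)].

Definition flag : set (set {vspace V}) :=
  [set X | [/\ X 0%VS, X fullv
             & forall W1 W2, X W1 -> X W2 -> (W1 <= W2)%VS \/ (W2 <= W1)%VS]].

Definition separates (X : set {vspace V}) (U1 U2 : {vspace V}) : Prop :=
  exists W, [/\ X W, (U1 <= W)%VS & ~~ (U2 <= W)%VS].

Definition B_flag (X : set {vspace V}) : subfunctor := fun R iota =>
  [set E | B iota E /\
           forall U1 U2 : nonzero_subspace, (val U1 <= val U2)%VS ->
             separates X (val U1) (val U2) ->
             tensor_sub iota (val U1) `<=` E U2].

Definition U_flag (X : set {vspace V}) : subfunctor := fun R iota =>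
  [set E | B iota E /\
           forall U1 U2 : nonzero_subspace, (val U1 <= val U2)%VS ->
             ~ separates X (val U1) (val U2) ->
             tensor_sub iota (val U2) =
             submodule_add (E U2) (tensor_sub iota (val U1))].

Definition Omega (X : set {vspace V}) : subfunctor := fun R iota =>
  B_flag X iota `&` U_flag X iota.

(* Pullback along h : R -> R'.  As the quotient (U (x) R) / E_U is pulled back
   to ((U (x) R) / E_U) (x)_R R', the submodule E_U is pulled back to the
   image of E_U (x)_R R' in U (x) R'. *)
Definition pullback (R R' : comPzRingType) (h : {rmorphism R -> R'})
    (E : family R) : family R' :=
  fun U => submodule_gen ((map_mx h : tensor V R -> tensor V R') @` E U).

(* The underlying set of a scheme is the set of equivalence classes of its
   field-valued points, two such being equivalent when they agree over a
   common extension field.  Collections of field-valued points are plain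
   predicates: field_point is too large a type for set. *)
Record field_point := FieldPoint {
  point_field : fieldType;
  point_structure : {rmorphism F -> point_field};
  point_family : family point_field }.

Arguments point_family : clear implicits.

Definition point_of (X : subfunctor) (x : field_point) : Prop :=
  X _ (point_structure x) (point_family x).

Definition same_point (x y : field_point) : Prop :=
  exists (L : fieldType) (hx : {rmorphism point_field x -> L})
         (hy : {rmorphism point_field y -> L}),
    hx \o point_structure x =1 hy \o point_structure y /\
    pullback hx (point_family x) = pullback hy (point_family y).

Definition underlying_set (X : subfunctor) (C : field_point -> Prop) : Prop :=
  exists2 x, point_of X x
    & C = (fun y => point_of X y /\ same_point x y).

(* The subset of the underlying set of X formed by the points of a subscheme
   Y of X. *)
Definition underlying_subset (X Y : subfunctor) (C : field_point -> Prop) :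
    Prop :=
  underlying_set X C /\ exists2 y, C y & point_of Y y.

End Space.

Arguments B {F} V {R} iota _.
Arguments flag {F} V _.

(* Main.v *)
Require Import Defs.
From mathcomp Require Import all_boot all_order all_algebra.
From mathcomp Require Import boolp classical_sets.

(** A point of [B_V] over a field [K] is a family of hyperplanes [E_U] in
    [U (x) K], increasing in [U].  The whole argument runs on the incidence
    relation [v (x) 1 \in E_U] between vectors of [V] and non-zero subspaces.

    Existence.  The vectors [v] of [U] with [v (x) 1 \in E_U] form a proper
    subspace [k U] of [U], because [E_U] is a proper subspace of [U (x) K]
    ([kernel_proper]).  Iterating [k] from [V] gives a strictly decreasing
    chain that ends at [0], hence a flag.  Let [U1 <= U2] be non-zero and let
    [W] be the smallest member of the chain containing [U2], so that [U2] is not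
    inside [k W] and [U2 (x) K] is not inside [E_W].  As [E_(U2)] is a
    hyperplane contained in [E_W], it is all of the intersection of [E_W] with
    [U2 (x) K].  If the flag separates [U1] from [U2], then [U1 <= k W], whence
    [U1 (x) K] lies in [E_W] and so in [E_(U2)].  If it does not, then [U1] is
    not inside [k W] either, so [U1 (x) K] is not inside [E_W], a fortiori not
    inside the hyperplane [E_(U2)], and the two span [U2 (x) K]
    ([chain_flag_Omega]).

    Uniqueness.  On the stratum of a flag [X], the inclusion of [U1 (x) K] in
    [E_(U2)] holds exactly when [X] separates [U1] from [U2]
    ([separatesP]), and a flag is determined by the pairs it separates
    ([flag_sub_of_separates]).  It remains to see that incidence depends only on
    the point of the underlying set and not on the field-valued point chosen to
    represent it: a linear subspace of [K^n] is the kernel of a matrix, and so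
    its extension to a larger field acquires no new [K]-rational vectors
    ([span_map_mxP]). *)

Set Implicit Arguments.
Unset Strict Implicit.
Unset Printing Implicit Defensive.

Import GRing.Theory.

Local Open Scope classical_set_scope.
Local Open Scope ring_scope.

(** * Submodules and hyperplanes *)

Section SubmoduleTheory.
Variables (R : comPzRingType) (M : lmodType R).
Implicit Types A N E : set M.

Lemma submodule_gen_submodule A : submodule (submodule_gen A).
Proof.
split=> [N [[N0 _] _] //|a x y Ax Ay N sN].
by have [[_ Nlin] _] := sN; apply: Nlin; [apply: Ax|apply: Ay].
Qed.

Lemma sub_submodule_gen A : A `<=` submodule_gen A.
Proof. by move=> x Ax N [_]; apply. Qed.

Lemma submodule_gen_sub A N :
  submodule N -> A `<=` N -> submodule_gen A `<=` N.
Proof. by move=> subN AN x; apply. Qed.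

Lemma submoduleZ N a x : submodule N -> N x -> N (a *: x).
Proof. by move=> [N0 Nlin] Nx; rewrite -[_ *: _]addr0; apply: Nlin. Qed.

Lemma submoduleD N x y : submodule N -> N x -> N y -> N (x + y).
Proof. by move=> [_ Nlin] Nx Ny; rewrite -[x]scale1r; apply: Nlin. Qed.

Lemma submoduleB N x y : submodule N -> N x -> N y -> N (x - y).
Proof.
move=> sN Nx Ny; apply: submoduleD => //.
by rewrite -scaleN1r; apply: submoduleZ.
Qed.

Lemma submodule_add_submodule N E :
  submodule N -> submodule E -> submodule (submodule_add N E).
Proof.
move=> sN sE; split.
  by exists 0; [exact: sN.1|exists 0; [exact: sE.1|rewrite addr0]].
move=> a _ _ [x Nx [y Ey <-]] [x' Nx' [y' Ey' <-]].
exists (a *: x + x'); first by apply: sN.2.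
by exists (a *: y + y'); [apply: sE.2|rewrite scalerDr addrACA].
Qed.

End SubmoduleTheory.

Section Hyperplanes.
Variables (K : fieldType) (M : lmodType K).
Implicit Types N E : set M.

Definition hyperplane N E : Prop :=
  exists v, [/\ N v, ~ E v & forall w, N w -> exists a, E (w - a *: v)].

(** A cover of the spectrum of a field by principal opens contains the whole
    spectrum, so that a locally free quotient is free. *)
Lemma hyperplane_of_quotient N E :
  submodule E -> quotient_locally_free1 N E -> hyperplane N E.
Proof.
move=> sE [m [c [f [sum1 free]]]].
have [i fi0] : exists i, f i != 0.
  apply: contrapT => nofi; move: (oner_neq0 K).
  rewrite -sum1 big1 ?eqxx // => i _.
  by case: (eqVneq (f i) 0) => [->|fi]; [rewrite mulr0|case: nofi; exists i].
have [v [Nv gen inj]] := free i; exists v; split=> // [Ev|w Nw].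
  have [k /eqP] : exists k, f i ^+ k * 1 = 0.
    by apply: (inj 0); rewrite expr0 mul1r scale1r.
  by rewrite mulr1 expf_eq0 (negbTE fi0) andbF.
have [k [a Ewv]] := gen w Nw; exists ((f i ^+ k)^-1 * a).
have := submoduleZ (f i ^+ k)^-1 sE Ewv.
by rewrite scalerBr !scalerA mulVf ?scale1r // expf_neq0.
Qed.

Lemma hyperplane_proper N E : hyperplane N E -> ~ N `<=` E.
Proof. by move=> [v [Nv nEv _]] /(_ v Nv). Qed.

(** A hyperplane is a maximal proper subspace: the quotient, having dimension
    one, is spanned by any of its non-zero vectors. *)
Lemma hyperplane_max N E E' z : submodule E -> hyperplane N E ->
  submodule E' -> E `<=` E' -> N z -> E' z -> ~ E z -> N `<=` E'.
Proof.
move=> sE [v [Nv nEv gen]] sE' EE' Nz E'z nEz w Nw.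
have [a Ezav] := gen z Nz; have [b Ewbv] := gen w Nw.
have a0 : a != 0 by apply/eqP => a0; apply: nEz; rewrite a0 scale0r subr0 in Ezav.
have E'v : E' v.
  have := submoduleZ a^-1 sE' (submoduleB sE' E'z (EE' _ Ezav)).
  by rewrite subKr scalerA mulVf // scale1r.
by rewrite -[w](subrK (b *: v)); apply: submoduleD => //;
  [apply: EE'|apply: submoduleZ].
Qed.

End Hyperplanes.

(** * Subspaces and extension of the ground field *)

(** Enlarging a subspace contained in [P] by one vector of [P] at a time must
    stop, by the bound on dimensions. *)
Lemma exists_vspace (K : fieldType) (V : vectType K) (P : V -> Prop) :
  P 0 -> (forall a x y, P x -> P y -> P (a *: x + y)) ->
  exists W : {vspace V}, forall v, v \in W <-> P v.
Proof.
move=> P0 Plin; apply: contrapT => noW.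
suff /(_ (\dim {:V}).+1)[W [_]] :
    forall n, exists W : {vspace V}, (forall v, v \in W -> P v) /\ (n <= \dim W)%N.
  by rewrite ltnNge dimvS ?subvf.
elim=> [|n [W [WP nW]]].
  by exists 0%VS; split=> // v; rewrite memv0 => /eqP->.
have [v Pv nWv] : exists2 v, P v & v \notin W.
  apply: contrapT => nov; apply: noW; exists W => v; split; first exact: WP.
  by move=> Pv; apply: contrapT => /negP nWv; apply: nov; exists v.
exists (W + <[v]>)%VS; split=> [_ /memv_addP[x Wx [_ /vlineP[a ->] ->]]|].
  by rewrite addrC; apply: Plin => //; apply: WP.
apply: leq_ltn_trans nW _; rewrite ltnNge; apply: contra nWv => dimW.
have /eqP-> : (W == W + <[v]>)%VS by rewrite eqEdim addvSl.
by apply: (subvP (addvSr _ _)); rewrite memv_line.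
Qed.

Lemma submodule_kermx (K : fieldType) n (E : set 'rV[K]_n) :
  submodule E -> exists M : 'M[K]_n, forall w, E w <-> w *m M = 0.
Proof.
move=> sE; have [W WE] := exists_vspace sE.1 sE.2.
exists (lin1_mx (\1%VF - projv W)%VF) => w.
rewrite mul_rV_lin1 /= !lfunE /= !lfunE /=.
split=> [/WE Ww|/eqP]; first by rewrite projv_id // subrr.
by rewrite subr_eq0 => /eqP->; apply/WE; rewrite memv_proj.
Qed.

(** The equations that cut out [E] still hold on its extension to [L], and they
    have coefficients in [K]. *)
Lemma span_map_mxP (K L : fieldType) (h : {rmorphism K -> L}) n
    (E : set 'rV[K]_n) (w : 'rV[K]_n) : submodule E ->
  submodule_gen ((map_mx h : 'rV[K]_n -> 'rV[L]_n) @` E) (map_mx h w) <-> E w.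
Proof.
move=> sE; split=> [|Ew]; last by apply: sub_submodule_gen; exists w.
have [M ME] := submodule_kermx sE.
move=> /(@submodule_gen_sub _ _ _ [set z | z *m map_mx h M = 0]) hw.
apply/ME/(@map_mx_inj _ _ h); rewrite map_mxM map_mx0; apply: hw.
  split=> [|a x y /= x0 y0]; first by rewrite /= mul0mx.
  by rewrite mulmxDl -scalemxAl x0 y0 scaler0 addr0.
by move=> _ [x /ME x0 <-] /=; rewrite -map_mxM x0 map_mx0.
Qed.

(** * Flags and the pairs that they separate *)

Section Flags.
Variables (F : finFieldType) (V : vectType F).
Implicit Types (X Y : set {vspace V}) (U W : {vspace V}).

(** A member [W] of [X] is separated by [X] from every larger subspace, in
    particular from the smallest member of [Y] containing [W]; if [Y] separates
    these two, they must coincide.  The induction descends to that smallest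
    member. *)
Lemma flag_sub_of_separates X Y : flag V X -> flag V Y ->
  (forall U1 U2, (U1 != 0)%VS -> (U2 != 0)%VS -> (U1 <= U2)%VS ->
     separates X U1 U2 -> separates Y U1 U2) ->
  X `<=` Y.
Proof.
move=> flX [Y0 Y1 Ytot] XY W XW.
have [->//|W0] := eqVneq W 0%VS.
suff H n : forall U, Y U -> (W <= U)%VS -> (\dim U < n)%N -> Y W.
  by apply: (H (\dim {:V}).+1 fullv); rewrite ?subvf.
elim: n => // n IHn U YU WU dimU.
have [UW|nUW] := boolP (U <= W)%VS.
  by have -> : W = U by apply/eqP; rewrite eqEsubv WU UW.
have U0 : (U != 0)%VS by apply: contraNneq nUW => ->; apply: sub0v.
have [U' [YU' WU' nUU']] : separates Y W U by apply: XY => //; exists W.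
have U'U : (U' <= U)%VS by case: (Ytot U U' YU YU') => // UU'; rewrite UU' in nUU'.
apply: (IHn U') => //; rewrite ltnS in dimU; apply: leq_trans dimU.
rewrite ltnNge.
by apply: contra nUU' => dimUU'; have := eqEdim U' U; rewrite U'U dimUU' => /eqP->.
Qed.

(** * Points over a field *)

Section Points.
Variables (K : fieldType) (iota : {rmorphism F -> K}) (E : Defs.family V K).
Hypothesis EB : B V iota E.
Implicit Type u : nonzero_subspace V.

Lemma point_submodule u : submodule (E u).
Proof. by case: (EB.1 u). Qed.

Lemma point_sub u : E u `<=` tensor_sub iota (val u).
Proof. by case: (EB.1 u). Qed.

Lemma point_hyperplane u : hyperplane (tensor_sub iota (val u)) (E u).
Proof. by case: (EB.1 u) => sE _; apply: hyperplane_of_quotient. Qed.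

Lemma tensor_sub_submodule (U : {vspace V}) : submodule (tensor_sub iota U).
Proof. exact: submodule_gen_submodule. Qed.

Lemma mem_tensor_sub (U : {vspace V}) v :
  v \in U -> tensor_sub iota U (tensor1 iota v).
Proof. by move=> Uv; apply: sub_submodule_gen; exists v. Qed.

Lemma nonzero_sub u U : (val u <= U)%VS -> (U != 0)%VS.
Proof. by apply: contraTneq => ->; rewrite subv0; apply: (valP u). Qed.

Lemma tensor_subS (U1 U2 : {vspace V}) :
  (U1 <= U2)%VS -> tensor_sub iota U1 `<=` tensor_sub iota U2.
Proof.
move=> U12; apply: submodule_gen_sub; first exact: tensor_sub_submodule.
by move=> _ [v Uv <-]; apply: mem_tensor_sub; apply: (subvP U12).
Qed.

Lemma tensor_sub_pointP (U : {vspace V}) u :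
  tensor_sub iota U `<=` E u <-> {in U, forall v, E u (tensor1 iota v)}.
Proof.
split=> [UE v Uv|UE]; first by apply: UE; apply: mem_tensor_sub.
apply: submodule_gen_sub; first exact: point_submodule.
by move=> _ [v Uv <-]; apply: UE.
Qed.

Lemma separatesP X u1 u2 : Omega X iota E -> (val u1 <= val u2)%VS ->
  tensor_sub iota (val u1) `<=` E u2 <-> separates X (val u1) (val u2).
Proof.
move=> [[_ EX] [_ EX']] u12; split=> [u1E|]; last exact: EX.
apply: contrapT => /(EX' _ _ u12) u2E.
apply: hyperplane_proper (point_hyperplane u2) _.
rewrite u2E => _ [x Ex [y /u1E Ey <-]].
exact: submoduleD (point_submodule u2) Ex Ey.
Qed.

(** A function on all subspaces, so that it can be iterated; it sends [0] to
    [0], the condition on [u] being void there. *)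
Lemma exists_kernels : exists k : {vspace V} -> {vspace V}, forall U v,
  v \in k U <->
  v \in U /\ forall u, val u = U -> E u (tensor1 iota v).
Proof.
suff /choice[k kP] : forall U : {vspace V}, exists W : {vspace V}, forall v,
    v \in W <-> v \in U /\ forall u, val u = U -> E u (tensor1 iota v).
  by exists k.
move=> U.
apply: exists_vspace => [|a x y [Ux Ex] [Uy Ey]]; split.
- exact: mem0v.
- have -> : tensor1 iota (0 : V) = 0.
    by apply/rowP => i; rewrite !mxE linear0 rmorph0.
  by move=> u _; have [] := point_submodule u.
- by rewrite memvD ?memvZ.
by move=> u uU; rewrite tensor1_linear; apply: (point_submodule u).2; auto.
Qed.

Section KernelChain.
Variable k : {vspace V} -> {vspace V}.
Hypothesis kP : forall U v,
  v \in k U <-> v \in U /\ forall u, val u = U -> E u (tensor1 iota v).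

Definition chain n := iter n k fullv.

Lemma kernel_sub U : (k U <= U)%VS.
Proof. by apply/subvP => v /kP[]. Qed.

Lemma sub_kernelP u U : (U <= val u)%VS ->
  (U <= k (val u))%VS <-> tensor_sub iota U `<=` E u.
Proof.
move=> Uu; rewrite tensor_sub_pointP; split=> [/subvP Uk v /Uk/kP[_]|UE].
  exact.
apply/subvP => v Uv; apply/kP; split; first exact: (subvP Uu).
by move=> u' /val_inj->; apply: UE.
Qed.

Lemma kernel_proper U : (U != 0)%VS -> (\dim (k U) < \dim U)%N.
Proof.
move=> U0; pose u : nonzero_subspace V := exist _ U U0.
rewrite ltnNge; apply/negP => dimU.
have kU : k U = U by apply/eqP; rewrite eqEdim kernel_sub dimU.
apply: hyperplane_proper (point_hyperplane u) _.
by apply/(@sub_kernelP u) => //=; rewrite kU.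
Qed.

Lemma chain_anti m n : (m <= n)%N -> (chain n <= chain m)%VS.
Proof.
move=> /subnK<-; elim: (n - m)%N => [|d IH]; first exact: subvv.
by rewrite addSn; apply: subv_trans (kernel_sub _) IH.
Qed.

Lemma chain_dim n : chain n = 0%VS \/ (\dim (chain n) + n <= \dim {:V})%N.
Proof.
elim: n => [|n]; first by right; rewrite addn0.
have [c0 _|c0] := eqVneq (chain n) 0%VS.
  by left; apply/eqP; rewrite -subv0 -c0 chain_anti.
case=> [c1|IH]; first by rewrite c1 eqxx in c0.
by right; apply: leq_trans IH; rewrite addnS -addSn leq_add2r; apply: kernel_proper.
Qed.

Lemma chain_eventually0 n : (\dim {:V} < n)%N -> chain n = 0%VS.
Proof. by case: (chain_dim n) => // + nV; rewrite leqNgt (leq_trans nV) ?leq_addl. Qed.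

Definition chain_flag : set {vspace V} := range chain.

Lemma chain_flagP : flag V chain_flag.
Proof.
split; first by exists (\dim {:V}).+1 => //; rewrite chain_eventually0.
  by exists 0%N.
move=> _ _ [m _ <-] [n _ <-].
by case: (leqP m n) => [|/ltnW] mn; [right|left]; apply: chain_anti.
Qed.

Lemma smallest_chain_member u : exists n,
  (val u <= chain n)%VS /\ ~ (val u <= chain n.+1)%VS.
Proof.
have ex0 : exists n, (val u <= chain n)%VS by exists 0%N; apply: subvf.
have bnd n : (val u <= chain n)%VS -> (n <= \dim {:V})%N.
  move/nonzero_sub => cn; rewrite leqNgt; apply/negP => /chain_eventually0.
  exact/eqP.
case: (ex_maxnP ex0 bnd) => n un nmax; exists n; split=> // /nmax.
by rewrite ltnn.
Qed.

Lemma chain_member_nz u n : (val u <= chain n)%VS ->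
  exists w : nonzero_subspace V, val w = chain n.
Proof.
by move/nonzero_sub => cn; exists (exist _ (chain n) cn).
Qed.

Lemma chain_flag_Omega : Omega chain_flag iota E.
Proof.
split; split=> // u1 u2 u12.
  move=> [_ [[m _ <-] u1m nu2m]].
  have [n [u2n nu2n]] := smallest_chain_member u2.
  have [w wn] := chain_member_nz u2n.
  have nm : (n < m)%N.
    by rewrite ltnNge; apply: contra nu2m => /chain_anti; apply: subv_trans.
  have u2w : (val u2 <= val w)%VS by rewrite wn.
  have u1E : tensor_sub iota (val u1) `<=` E w.
    apply/sub_kernelP; first exact: subv_trans u2w.
    by rewrite wn; apply: subv_trans u1m (chain_anti nm).
  (* a [z] outside [E u2] would span with it all of [u2 (x) K], inside [E w] *)
  move=> z u1z; apply: contrapT => nEz; apply: nu2n.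
  rewrite /chain /= -/(chain n) -wn; apply/sub_kernelP => //.
  apply: hyperplane_max (point_hyperplane u2) _ _ _ (u1E _ u1z) nEz;
    [exact: point_submodule|exact: point_submodule|exact: EB.2|].
  exact: tensor_subS u12 _ u1z.
move=> nsep; have [n [u1n nu1n]] := smallest_chain_member u1.
have [w wn] := chain_member_nz u1n.
have u2w : (val u2 <= val w)%VS.
  rewrite wn; apply: contrapT => /negP nu2n; apply: nsep.
  by exists (chain n); split=> //; exists n.
have [z u1z nEz] : exists2 z, tensor_sub iota (val u1) z & ~ E u2 z.
  apply: contrapT => noz; apply: nu1n.
  rewrite /chain /= -/(chain n) -wn; apply/sub_kernelP; first by rewrite wn.
  move=> z u1z; apply: EB.2 u2w _ _; apply: contrapT => nEz.
  by apply: noz; exists z.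
have gen1 := tensor_sub_submodule (val u1).
have E2 := point_submodule u2.
apply/seteqP; split=> [|_ [x Ex [y u1y <-]]].
  apply: hyperplane_max (point_hyperplane u2) _ _ _ _ nEz => //.
  - exact: submodule_add_submodule.
  - by move=> x Ex; exists x => //; exists 0; [exact: gen1.1|rewrite addr0].
  - exact: tensor_subS u12 _ u1z.
  by exists 0; [exact: E2.1|exists z; rewrite ?add0r].
by apply: submoduleD (tensor_sub_submodule _) (point_sub Ex) (tensor_subS u12 u1y).
Qed.

End KernelChain.

Lemma exists_flag : exists2 X, flag V X & Omega X iota E.
Proof.
by have [k kP] := exists_kernels; exists (chain_flag k);
  [apply: chain_flagP|apply: chain_flag_Omega].
Qed.

End Points.

(** * Independence of the chosen field-valued point *)

Lemma map_tensor1 (K L : fieldType) (h : {rmorphism K -> L})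
    (iota : {rmorphism F -> K}) (v : V) :
  map_mx h (tensor1 iota v) = \row_i (h \o iota) (coord (vbasis {:V}) i v).
Proof. by apply/rowP => i; rewrite !mxE. Qed.

Lemma same_point_incidence (x y : field_point V)
    (u : nonzero_subspace V) (v : V) :
  point_of (@B F V) x -> point_of (@B F V) y -> same_point x y ->
  point_family (f := x) u (tensor1 (point_structure x) v) <->
  point_family (f := y) u (tensor1 (point_structure y) v).
Proof.
move=> Bx By [L [hx [hy [hxy pull]]]].
rewrite -(span_map_mxP hx _ (point_submodule Bx u)).
rewrite -(span_map_mxP hy _ (point_submodule By u)).
have -> : map_mx hx (tensor1 (point_structure x) v)
        = map_mx hy (tensor1 (point_structure y) v).
  by rewrite !map_tensor1; apply/rowP => i; rewrite !mxE hxy.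
by have /(congr1 (fun E => E u)) := pull; rewrite /pullback => ->.
Qed.

Lemma same_point_refl (x : field_point V) : same_point x x.
Proof. by exists (point_field x), idfun, idfun. Qed.

Lemma Omega_flag_sub X Y (x y z : field_point V) : flag V X -> flag V Y ->
  point_of (@B F V) x -> same_point x y -> same_point x z ->
  point_of (@Omega F V X) y -> point_of (@Omega F V Y) z -> X `<=` Y.
Proof.
move=> flX flY Bx xy xz Xy Yz.
have By : point_of (@B F V) y := Xy.1.1.
have Bz : point_of (@B F V) z := Yz.1.1.
apply: flag_sub_of_separates => // U1 U2 U10 U20 U12.
pose u1 : nonzero_subspace V := exist _ U1 U10.
pose u2 : nonzero_subspace V := exist _ U2 U20.
move/(@separatesP _ _ _ By X u1 u2 Xy U12)/(tensor_sub_pointP By) => yU.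
apply/(@separatesP _ _ _ Bz Y u1 u2 Yz U12)/(tensor_sub_pointP Bz) => v /yU.
by move/(same_point_incidence u2 v Bx By xy)/(same_point_incidence u2 v Bx Bz xz).
Qed.

End Flags.

(** * The stratification *)

Theorem theorem10p8 (F : finFieldType) (V : vectType F)
    (V_neq0 : ({:V} != 0)%VS) :
  (forall C : field_point V -> Prop,
     underlying_set (@B F V) C <->
     exists2 X : set {vspace V},
       flag V X & underlying_subset (@B F V) (@Omega F V X) C) /\
  (forall (X Y : set {vspace V}) (C : field_point V -> Prop),
     flag V X -> flag V Y ->
     underlying_subset (@B F V) (@Omega F V X) C ->
     underlying_subset (@B F V) (@Omega F V Y) C -> X = Y).
Proof.
split=> [C|X Y C flX flY [[x Bx ->] [y [_ xy] Xy]] [_ [z [_ xz] Yz]]].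
  split=> [BC|[X _ []]//]; have [x Bx defC] := BC.
  have [X flX Xx] := exists_flag Bx; exists X => //; split=> //.
  by exists x; rewrite // defC; split=> //; apply: same_point_refl.
by apply/seteqP; split;
  [apply: Omega_flag_sub Bx xy xz Xy Yz|apply: Omega_flag_sub Bx xz xy Yz Xy].
Qed.
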